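(* With $w^T(t) = e^{B(T-t)}\mathfrak{g}$ for $t\in[0,T]$ (a vector all of whose coordinates are positive), the following hold. (1) For all $i \in \mathcal{N}$ and all $t \in [0,T]$, $u^T_i(t) = \log(w^T_i(t))$, where $u^T_i$ is the value function. (2) The optimal controls for the control problem $$\sup_{\lambda \in \mathcal{A}^T_0} \mathbb{E}\left[-\int_0^T L\left(X^{0,i,\lambda}_t, \left(\lambda_t(X^{0,i,\lambda}_t, j)\right)_{j \in \mathcal{V}(X^{0,i,\lambda}_t)}\right)dt + g\left(X^{0,i,\lambda}_T\right)\right]$$ (for a starting node $i \in \mathcal{N}$) are given in feedback form by $$\forall i \in \mathcal{N}, \ \forall j \in \mathcal{V}(i), \ \forall t \in [0,T], \quad \lambda^{T*}_t(i,j) = \bar\lambda_{ij}\frac{w^T_j(t)}{w^T_i(t)};$$ that is, $\lambda^{T*} \in \mathcal{A}^T_0$ and, for every starting node $i\in\mathcal{N}$, the supremum over $\lambda \in \mathcal{A}^T_0$ of $\mathbb{E}\left[-\int_0^T L\left(X^{0,i,\lambda}_t, \left(\lambda_t(X^{0,i,\lambda}_t, j)\right)_{j \in \mathcal{V}(X^{0,i,\lambda}_t)}\right)dt + g\left(X^{0,i,\lambda}_T\right)\right]$ is attained at $\lambda = \lambda^{T*}$.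
   Context: Let $T>0$ and let $(\Omega, (\mathcal{F}_t)_{t\in[0,T]}, \mathbb{P})$ be a filtered probability space satisfying the usual conditions, on which all processes are defined and adapted. Let $\mathcal{G}$ be a finite directed graph with no self-loop, with set of nodes $\mathcal{N} = \{1,\ldots,N\}$, $N \ge 2$. For each $i \in \mathcal{N}$, $\mathcal{V}(i) \subset \mathcal{N}\setminus\{i\}$ denotes the set of nodes $j$ for which there is a directed edge from $i$ to $j$. Let $r : \mathcal{N} \to \mathbb{R}$ (instantaneous reward) and $g : \mathcal{N} \to \mathbb{R}$ (terminal reward) be functions, and let $(\bar\lambda_{ij})_{i \in \mathcal{N}, j \in \mathcal{V}(i)}$ be positive real numbers. Admissible controls: for $t\in[0,T]$, $\mathcal{A}^T_t$ is the set of families $(\lambda_s(i,j))_{s\in[t,T], i\in\mathcal{N}, j\in\mathcal{V}(i)}$ that are deterministic, nonnegative, and such that for all $i \in \mathcal{N}$ and $j\in\mathcal{V}(i)$ the function $s\mapsto \lambda_s(i,j)$ is in $L^1(t,T)$. Cost: for $i\in\mathcal{N}$ and $(\lambda_{ij})_{j\in\mathcal{V}(i)} \in \mathbb{R}_+^{|\mathcal{V}(i)|}$, $$L\left(i,(\lambda_{ij})_{j\in\mathcal{V}(i)}\right) = -r(i) + \sum_{j\in\mathcal{V}(i)}\left(\lambda_{ij}\log\left(\frac{\lambda_{ij}}{\bar\lambda_{ij}}\right) + \bar\lambda_{ij} - \lambda_{ij}\right),$$ with the convention that $x\log(x)$ is extended by continuity by the value $0$ at $x=0$. For $\lambda\in\mathcal{A}^T_t$,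 $(X^{t,i,\lambda}_s)_{s\in[t,T]}$ denotes the continuous-time Markov chain on $\mathcal{G}$ starting from node $i$ at time $t$ with (time-dependent) transition intensities given by $\lambda$ (at time $s$, the intensity of jumping from $k$ to $j\in\mathcal{V}(k)$ is $\lambda_s(k,j)$). The value function is, for $i\in\mathcal{N}$ and $t\in[0,T]$, $$u^T_i(t) = \sup_{\lambda \in \mathcal{A}^T_t} \mathbb{E}\left[-\int_t^T L\left(X^{t,i,\lambda}_s, \left(\lambda_s(X^{t,i,\lambda}_s, j)\right)_{j \in \mathcal{V}(X^{t,i,\lambda}_s)}\right)ds + g\left(X^{t,i,\lambda}_T\right)\right].$$ Matrix $B$: $B = R + \bar\Lambda$, where $R = \mathrm{diag}(r(1),\ldots,r(N))$ and $\bar\Lambda$ is the $N\times N$ matrix with $\bar\Lambda_{ij} = \bar\lambda_{ij}$ if $j\in\mathcal{V}(i)$, $\bar\Lambda_{ii} = -\sum_{k\in\mathcal{V}(i)}\bar\lambda_{ik}$, and $\bar\Lambda_{ij}=0$ otherwise. The column vector $\mathfrak{g}$ is $(e^{g(1)},\ldots,e^{g(N)})'$, where $'$ denotes transposition. *)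

(* Defs.v *)
From HB Require Import structures.
From mathcomp Require Import all_boot all_order all_algebra.
From mathcomp Require Import all_classical all_reals all_analysis.
Set Implicit Arguments.
Unset Strict Implicit.
Unset Printing Implicit Defensive.
Import Order.TTheory GRing.Theory Num.Theory.
Import numFieldNormedType.Exports.
Local Open Scope classical_set_scope.
Local Open Scope ring_scope.

Section Defs.
Context {R : realType} {N : nat}.

(* The graph is given by its successor sets: [j \in V i] means that there is an
   edge from [i] to [j]. Families indexed by the edges are total functions of
   two nodes; their values outside of the edges are never used. *)
Implicit Types (V : 'I_N -> {set 'I_N}) (lbar rate : 'I_N -> 'I_N -> R).
Implicit Types (r g : 'I_N -> R) (lam : R -> 'I_N -> 'I_N -> R).

Local Notation mu := (@lebesgue_measure R).

Definition generator V rate : 'M[R]_N :=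
  \matrix_(i, j) if j \in V i then rate i j
                 else if j == i then - \sum_(k in V i) rate i k
                 else 0.

Definition matB V r lbar : 'M[R]_N :=
  diag_mx (\row_i r i) + generator V lbar.

Definition mxexp (A : 'M[R]_N) : 'M[R]_N :=
  limn (series (fun k : nat => (k`!%:R)^-1 *: A ^+ k)).

Definition wvec V r g lbar (T t : R) : 'cV[R]_N :=
  mxexp ((T - t) *: matB V r lbar) *m \col_i expR (g i).

Definition admissible V (T t : R) lam :=
  forall i j, j \in V i ->
    (forall s, s \in `[t, T] -> 0 <= lam s i j) /\
    mu.-integrable `[t, T] (fun s => (lam s i j)%:E).

(* Since [ln 0 = 0], a zero intensity contributes [lbar i j], in accordance
   with the convention [x log x = 0] at [x = 0]. *)
Definition cost V r lbar (i : 'I_N) (l : 'I_N -> R) : R :=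
  - r i + \sum_(j in V i) (l j * ln (l j / lbar i j) + lbar i j - l j).

(* Kolmogorov forward equation, in integral form since the intensities are only
   integrable in time: [p s v] is the matrix of transition probabilities between
   the times [s] and [v]. *)
Definition transition_matrices V (T t : R) lam (p : R -> R -> 'M[R]_N) :=
  forall s v, t <= s -> s <= v -> v <= T -> forall k j,
    let dp u := (p s u *m generator V (lam u)) k j in
    [/\ 0 <= p s v k j, \sum_l p s v k l = 1,
        mu.-integrable `[s, v] (EFin \o dp) &
        p s v k j = (k == j)%:R + \int[mu]_(u in `[s, v]) dp u].

Context {d : measure_display} {Omega : measurableType d}.
Variable P : probability Omega R.
Implicit Types (F : R -> set (set Omega)) (X : R -> Omega -> 'I_N).

Record usual_filtration (T : R) F : Prop := UsualFiltration {
  filtration_sigma_algebra :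
    forall t, 0 <= t <= T -> sigma_algebra setT (F t);
  filtration_measurable :
    forall t, 0 <= t <= T -> F t `<=` measurable;
  filtration_nondecreasing :
    forall s t, 0 <= s -> s <= t -> t <= T -> F s `<=` F t;
  filtration_right_continuous :
    forall t, 0 <= t < T -> F t = \bigcap_(s in `]t, T]) F s;
  filtration_complete : P.-negligible `<=` F 0 }.

(* [X], defined on the time interval [t, T], is a continuous-time Markov chain
   with respect to [F], started from [i] at time [t], with intensities [lam].
   The two path conditions say that the trajectories are right-continuous with
   left limits for the discrete topology on the nodes. The Markov property is
   written without conditional expectation, by integrating
   P(X_v = j | F_s) = p_{s,v}(X_s, j) over A `&` {X_s = k}, with A in F_s. *)
Record markov_chain V F (T t : R) (i : 'I_N) lam X : Prop := MarkovChain {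
  chain_adapted : forall s, t <= s <= T -> forall k, F s (X s @^-1` [set k]);
  chain_right_continuous : forall w s, t <= s < T ->
    \forall u \near s^'+, X u w = X s w;
  chain_left_limits : forall w s, t < s <= T ->
    exists k, \forall u \near s^'-, X u w = k;
  chain_start : P (X t @^-1` [set i]) = 1%E;
  chain_markov : exists2 p, transition_matrices V T t lam p &
    forall s v, t <= s -> s <= v -> v <= T -> forall A, F s A -> forall k j,
      P (A `&` X s @^-1` [set k] `&` X v @^-1` [set j]) =
      (P (A `&` X s @^-1` [set k]) * (p s v k j)%:E)%E }.

(* The costs are bounded below, but their time integral may be [+oo], as
   [x log x] need not be integrable along an integrable control; hence the
   criterion takes its values in [\bar R] and may be [-oo]. *)
Definition criterion V r g lbar (T t : R) lam X : \bar R :=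
  (\int[P]_w (- (\int[mu]_(s in `[t, T]) (cost V r lbar (X s w) (lam s (X s w)))%:E)
              + (g (X T w))%:E))%E.

(* [X t i lam] is the chain started from [i] at time [t], controlled by [lam]. *)
Definition value V r g lbar (T : R)
    (X : R -> 'I_N -> (R -> 'I_N -> 'I_N -> R) -> R -> Omega -> 'I_N)
    (i : 'I_N) (t : R) : \bar R :=
  ereal_sup [set criterion V r g lbar T t lam (X t i lam) |
             lam in admissible V T t].

Definition opt_control V r g lbar (T t : R) (i j : 'I_N) : R :=
  lbar i j * (wvec V r g lbar T t j 0 / wvec V r g lbar T t i 0).

End Defs.

(* Main.v *)
Require Import Defs.
From HB Require Import structures.
From mathcomp Require Import all_boot all_order all_algebra.
From mathcomp Require Import all_classical all_reals all_analysis.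
From mathcomp Require Import measurable_realfun.
From mathcomp Require Import ring lra.
Import Order.TTheory GRing.Theory Num.Theory.
Import numFieldNormedType.Exports.
Local Open Scope classical_set_scope.
Local Open Scope ring_scope.

Set Implicit Arguments.
Unset Strict Implicit.
Unset Printing Implicit Defensive.

(** Why the theorem holds.  The vector [w] solves the linear backward equation
    [w' = - B w] with [w T = e^g]; since the off-diagonal entries of [B] are
    nonnegative, [exp (x B)] maps positive vectors to positive vectors when
    [0 <= x], so that [u = ln w] makes sense ([expmx_metzler_gt0]).

    The logarithm turns the linear equation into the Hamilton-Jacobi-Bellman
    equation: by the duality between [l ln (l / b) + b - l] and the exponential
    ([poisson_young]), every choice [l] of intensities out of the node [k] satisfies
    [u_k' + sum_j l_j (u_j - u_k) <= cost k l], with equality for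
    [l_j = lbar k j * w_j / w_k] ([hjb_le], [hjb_eq]).  The difference of the two
    sides is called the gap.

    For an admissible control, let [m_k s] be the probability that the chain is
    at [k] at time [s].  Integrating [sum_k m_k u_k] by parts along the forward
    equation shows that the criterion is exactly
    [u_i t - \int_t^T sum_k m_k(s) gap_k(s) ds] ([criterion_gap]).  It is therefore
    at most [u_i t], with equality when the gap vanishes, that is for the
    feedback control of the statement.

    Three points need care.  The intensities are merely integrable in time, so
    [m] is only absolutely continuous and the integration by parts is an instance
    of Fubini's theorem ([primitive_by_parts]).  Exchanging the expectation and
    the time integral requires the joint measurability of the chain in time and
    randomness, which comes from the right-continuity of its paths
    ([measurable_occupation]).  Finally the running cost may have an infinite time
    integral; it is made nonnegative by adding [sum_k |r k|], so that Tonelli's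
    theorem applies and no indeterminate form arises ([integralD_ge0l],
    [integralB_ge0r]). *)

(** * Exponential generating functions and the matrix exponential *)

Section EGF.
Variable R : realType.
Implicit Types (a b : nat -> R) (K C x : R).

(** Power series with coefficients [a k / k!]: differentiation is the shift of [a],
    so that the entries of a matrix exponential are handled as scalar series. *)
Definition egf a x : R := limn (pseries (fun k => a k / k`!%:R) x).

(** The geometric growth of [a] is enough for convergence on the whole line,
    by comparison with the exponential series. *)
Lemma is_cvg_egf a C K x : (forall k, `|a k| <= C * K ^+ k) ->
  cvgn (pseries (fun k => a k / k`!%:R) x).
Proof.
move=> aK; apply: normed_cvg.
apply: (@series_le_cvg _ _ (fun k => C * (exp_coeff (`|K| * `|x|) k))).
- by move=> k; exact: normr_ge0.
- move=> k; rewrite mulr_ge0 ?exp_coeff_ge0 ?mulr_ge0//.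
  by have := le_trans (normr_ge0 _) (aK 0%N); rewrite expr0 mulr1.
- move=> k; rewrite /exp_coeff /= !normrM normfV normrX (ger0_norm (ler0n _ _)) exprMn.
  rewrite mulrAC -mulrA [leRHS]mulrA.
  rewrite [leRHS](_ : _ = C * `|K| ^+ k * (`|x| ^+ k / k`!%:R)); last by rewrite !mulrA.
  rewrite ler_wpM2r ?mulr_ge0 ?invr_ge0 ?exprn_ge0//.
  apply: (le_trans (aK k)); rewrite ler_wpM2l//.
    by have := le_trans (normr_ge0 _) (aK 0%N); rewrite expr0 mulr1.
  by rewrite -normrX ler_norm.
- exact: (is_cvg_seriesZ (is_cvg_series_exp_coeff _)).
Qed.

Lemma is_derive_egf a C K x : (forall k, `|a k| <= C * K ^+ k) ->
  is_derive x (1 : R) (egf a) (egf (fun k => a k.+1) x).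
Proof.
move=> aK.
have aKS : forall k, `|a k.+1| <= (C * K) * K ^+ k.
  by move=> k; rewrite -mulrA -exprS.
have aKSS : forall k, `|a k.+2| <= (C * K * K) * K ^+ k.
  by move=> k; rewrite -mulrA -exprS.
have diffs b : pseries_diffs (fun k => b k / k`!%:R) =
    (fun k => b k.+1 / k`!%:R).
  apply/funext => k; rewrite /pseries_diffs factS natrM invfM.
  by rewrite mulrCA (mulrA k.+1%:R) mulfV ?pnatr_eq0// mul1r.
rewrite /egf -(diffs a).
(* The radius of convergence is infinite; any point beyond [`|x|] would do. *)
apply: (@pseries_snd_diffs _ _ (`|x| + 1)).
- exact: is_cvg_egf aK.
- rewrite diffs; exact: is_cvg_egf aKS.
- rewrite diffs (diffs (fun k => a k.+1)); exact: is_cvg_egf aKSS.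
- by rewrite [ltRHS]ger0_norm ?addr_ge0// ltrDl.
Qed.

Lemma egf_lincomb (I : finType) (c : I -> R) (f : I -> nat -> R) C K x :
  (forall l k, `|f l k| <= C * K ^+ k) ->
  egf (fun k => \sum_l c l * f l k) x = \sum_l c l * egf (f l) x.
Proof.
move=> fK; apply/cvg_lim => //.
have -> : pseries (fun k => (\sum_l c l * f l k) / k`!%:R) x =
    (fun n => \sum_l c l * pseries (fun k => f l k / k`!%:R) x n).
  apply/funext => n; rewrite /pseries /series/=.
  under eq_bigr do rewrite mulr_suml mulr_suml.
  rewrite exchange_big/=; apply: eq_bigr => l _.
  by rewrite mulr_sumr; apply: eq_bigr => k _; rewrite !mulrA.
apply: cvg_big => [|l _]; first exact: add_continuous.
apply: cvgM; first exact: cvg_cst.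
exact: is_cvg_egf (fK l).
Qed.

Lemma egf0 a : egf a 0 = a 0%N.
Proof.
apply/cvg_lim => //; rewrite -cvg_shiftS/=.
apply: cvg_near_cst; near=> n.
rewrite /pseries/series/= big_nat_recl//= expr0 fact0 invr1 !mulr1.
by rewrite big1 ?addr0// => i _; rewrite expr0n/= mulr0.
Unshelve. all: by end_near. Qed.

(** All terms of the series are nonnegative, and the first one is [a 0]. *)
Lemma egf_ge a C K x : (forall k, `|a k| <= C * K ^+ k) ->
  (forall k, 0 <= a k) -> 0 <= x -> a 0%N <= egf a x.
Proof.
move=> aK a0 x0; apply: limr_ge; first exact: is_cvg_egf aK.
near=> n; have n0 : (0 < n)%N by near: n; exists 1%N.
rewrite /pseries/series/= -(prednK n0) big_nat_recl//= expr0 fact0 invr1 !mulr1.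
by rewrite lerDl sumr_ge0// => i _; rewrite mulr_ge0 ?mulr_ge0 ?exprn_ge0.
Unshelve. all: by end_near. Qed.

End EGF.

Section MatrixExponential.
Variables (R : realType) (N : nat).
Implicit Types (A : 'M[R]_N) (x : R).

(** The witness is the sum of the absolute values of all entries, which bounds
    every row sum. *)
Lemma mx_exprn_entry_le A : exists K, forall k i j, `|(A ^+ k) i j| <= 1 * K ^+ k.
Proof.
exists (\sum_i \sum_j `|A i j|) => k; rewrite mul1r; elim: k => [|k IH] i j.
  by rewrite !expr0 mxE; case: (_ == _); rewrite ?mulr1n ?mulr0n ?normr1 ?normr0.
rewrite exprS mxE (le_trans (ler_norm_sum _ _ _))//.
rewrite exprS; set S := \sum_i \sum_j _.
apply: (@le_trans _ _ ((\sum_l `|A i l|) * S ^+ k)); last first.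
  apply: ler_wpM2r; first by apply: le_trans (IH i j).
  rewrite /S [leRHS](bigD1 i)//= lerDl sumr_ge0// => i0 _.
  by apply: sumr_ge0 => j0 _.
rewrite mulr_suml; apply: ler_sum => l _; rewrite normrM.
exact: ler_wpM2l.
Qed.

Definition expmx A x : 'M[R]_N := \matrix_(i, j) egf (fun k => (A ^+ k) i j) x.

Lemma cvg_mx_entry (T : Type) (F : set_system T) (FF : Filter F) m n
  (f : T -> 'M[R]_(m, n)) (M : 'M[R]_(m, n)) :
  (forall i j, f x i j @[x --> F] --> M i j) -> f x @[x --> F] --> M.
Proof.
move=> fM; apply/cvg_mx_entourageP => E entE; near=> x => i j.
rewrite inE; move: (i) (j); near: x.
apply: filter_forall => i0; apply: filter_forall => j0.
by have /cvg_app_entourageP := fM i0 j0; exact.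
Unshelve. all: by end_near. Qed.

Lemma mx_exprZ A x k : (x *: A) ^+ k = x ^+ k *: A ^+ k.
Proof.
elim: k => [|k IH]; first by rewrite !expr0 scale1r.
by rewrite !exprS IH -[LHS]scalemxAl -[X in _ *: X]scalemxAr scalerA.
Qed.

Lemma mxexpE A x : mxexp (x *: A) = expmx A x.
Proof.
have [K AK] := mx_exprn_entry_le A.
apply/cvg_lim => //; apply: cvg_mx_entry => i j.
rewrite mxE; pose a k := (A ^+ k) i j.
rewrite [X in X @ _ --> _](_ : _ = pseries (fun k => a k / k`!%:R) x).
  exact: (is_cvg_egf (fun k => AK k i j)).
apply/funext => n; rewrite /pseries /series/= summxE.
apply: eq_bigr => k _; rewrite mxE mx_exprZ mxE /a.
by rewrite mulrC [x ^+ k * _]mulrC mulrAC.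
Qed.

Lemma expmx0 A : expmx A 0 = 1%:M.
Proof. by apply/matrixP => i j; rewrite mxE egf0 expr0. Qed.

Lemma is_derive_expmx A x i j :
  is_derive x (1 : R) (fun y => expmx A y i j) ((A *m expmx A x) i j).
Proof.
have [K AK] := mx_exprn_entry_le A.
have -> : (fun y => expmx A y i j) = egf (fun k => (A ^+ k) i j).
  by apply/funext => y; rewrite mxE.
rewrite mxE; under eq_bigr do rewrite mxE.
rewrite -(egf_lincomb _ (C := 1) (K := K)); last by move=> l k; exact: AK.
have := is_derive_egf x (fun k => AK k i j).
by congr is_derive; congr egf; apply/funext => k; rewrite exprS mxE.
Qed.

(** Expand [A ^+ k.+1] as [A ^+ k * A] and as [A * A ^+ k]. *)
Lemma expmx_comm A x : expmx A x *m A = A *m expmx A x.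
Proof.
have [K AK] := mx_exprn_entry_le A.
apply/matrixP => i j; rewrite !mxE.
under eq_bigr do rewrite mxE mulrC.
under [RHS]eq_bigr do rewrite mxE.
rewrite -!(egf_lincomb _ (C := 1) (K := K)); try by move=> l k; exact: AK.
congr egf; apply/funext => k.
transitivity ((A ^+ k * A) i j).
  by rewrite [RHS]mxE; apply: eq_bigr => l _; rewrite mulrC.
by rewrite -exprSr exprS mxE.
Qed.

End MatrixExponential.

(** * Positivity of the flow of a matrix with nonnegative off-diagonal entries *)

(** The differentiation rules yield sums and products of functions, to be matched
    with functions of an explicit variable and with a simplified derivative. *)
Lemma is_derive_ext (R : realType) (x : R) (f h : R -> R) df dh :
  is_derive x (1 : R) f df -> f =1 h -> df = dh -> is_derive x (1 : R) h dh.
Proof. by move=> fx /funext <- <-. Qed.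

Section MetzlerPositivity.
Variables (R : realType) (N : nat).
Implicit Types (A : 'M[R]_N) (G : 'cV[R]_N) (x : R).

Lemma is_derive_expmx_mul A G x i :
  is_derive x (1 : R) (fun y => (expmx A y *m G) i 0)
    ((A *m (expmx A x *m G)) i 0).
Proof.
have -> : (fun y => (expmx A y *m G) i 0) =
    \sum_j (fun y => expmx A y i j * G j 0).
  by apply/funext => y; rewrite fct_sumE mxE.
rewrite mulmxA mxE.
apply: is_derive_sum => j.
have := is_deriveM (is_derive_expmx A x i j) (is_derive_cst (G j 0) x (1 : R)).
by move/is_derive_ext; apply=> //; rewrite scaler0 add0r /GRing.scale/= mulrC.
Qed.

Lemma expmx_ge1 A G x i : (forall i j, 0 <= A i j) -> (forall j, 0 <= G j 0) ->
  0 <= x -> G i 0 <= (expmx A x *m G) i 0.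
Proof.
move=> A0 G0 x0; have [K AK] := mx_exprn_entry_le A.
have Ak0 k a b : 0 <= (A ^+ k) a b.
  elim: k a b => [|k IH] a b; first by rewrite expr0 mxE ler0n.
  by rewrite exprS mxE sumr_ge0// => l _; rewrite mulr_ge0.
have E0 a b : (1%:M : 'M[R]_N) a b <= expmx A x a b.
  have := egf_ge (fun k => AK k a b) (fun k => Ak0 k a b) x0.
  by rewrite expr0 [expmx _ _ _ _]mxE.
rewrite -[in leLHS](mul1mx G) !mxE; apply: ler_sum => j _.
exact: ler_wpM2r.
Qed.

(** The function [s |-> exp ((x - s)(A + cI)) (e^(cs) exp (sA) G)] has a vanishing
    derivative; its values at [0] and [x] are the two sides.  This replaces the
    multiplicativity of the exponential on commuting matrices. *)
Lemma expmx_shift A G c x i :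
  (expmx (A + c%:M) x *m G) i 0 = expR (c * x) * (expmx A x *m G) i 0.
Proof.
pose A' := A + c%:M.
pose y s := expR (c * s) *: (expmx A s *m G).
pose D s := (expmx A' (x - s) *m y s) i 0.
have dy s j : is_derive s (1 : R) (fun s => y s j 0) ((A' *m y s) j 0).
  have -> : (fun s => y s j 0) =
      (fun s => expR (c * s)) * (fun s => (expmx A s *m G) j 0).
    by apply/funext => z; rewrite /y mxE.
  have dl : is_derive s (1 : R) (fun s => expR (c * s)) (c * expR (c * s)).
    have : is_derive s (1 : R) (fun s => c * s) c.
      have := is_deriveZ c (is_derive_id s (1 : R)).
      by move/is_derive_ext; apply=> //; rewrite /GRing.scale/= mulr1.
    move=> h; have := is_derive1_comp (is_derive_expR (c * s)) h.
    by move/is_derive_ext; apply=> //; rewrite mulrC.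
  have := is_deriveM dl (is_derive_expmx_mul A G s j).
  move/is_derive_ext; apply=> //.
  rewrite /A' /y -scalemxAr mulmxDl mul_scalar_mx !mxE /GRing.scale/=.
  by rewrite mulrDr; congr (_ + _); ring.
have dE s j : is_derive s (1 : R) (fun s => expmx A' (x - s) i j)
    (- (expmx A' (x - s) *m A') i j).
  rewrite expmx_comm.
  have h : is_derive s (1 : R) (fun s => x - s) (-1).
    have := is_deriveB (is_derive_cst x s (1 : R)) (is_derive_id s (1 : R)).
    by move/is_derive_ext; apply=> //; rewrite sub0r.
  have := @is_derive1_comp _ (fun z => expmx A' z i j) (fun s => x - s) s _ _
    (is_derive_expmx A' (x - s) i j) h.
  by move/is_derive_ext; apply=> //; rewrite mulrN1.
have dD s : is_derive s (1 : R) D 0.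
  have -> : D = \sum_j ((fun s => expmx A' (x - s) i j) * (fun s => y s j 0)).
    by apply/funext => z; rewrite fct_sumE /D mxE.
  have : is_derive s (1 : R)
      (\sum_j ((fun s => expmx A' (x - s) i j) * (fun s => y s j 0)))
      (\sum_j (expmx A' (x - s) i j *: (A' *m y s) j 0 +
         y s j 0 *: - (expmx A' (x - s) *m A') i j)).
    by apply: is_derive_sum => j; exact: is_deriveM (dE s j) (dy s j).
  move/is_derive_ext; apply=> //.
  rewrite big_split/=.
  under [X in _ + X]eq_bigr do rewrite /GRing.scale/= mulrN mulrC.
  rewrite sumrN.
  transitivity ((expmx A' (x - s) *m (A' *m y s)) i 0 -
                ((expmx A' (x - s) *m A') *m y s) i 0); first by rewrite !mxE.
  by rewrite mulmxA subrr.
have := is_derive_0_is_cst 0 x dD.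
rewrite /D subr0 subrr /y mulr0 expR0 !scale1r !expmx0 !mul1mx. by rewrite [RHS]mxE.
Qed.

(** Shifting [A] by a large multiple of the identity makes it entrywise
    nonnegative, and multiplies the flow by a positive scalar. *)
Lemma expmx_metzler_gt0 A G x i : (forall a b, a != b -> 0 <= A a b) ->
  (forall j, 0 < G j 0) -> 0 <= x -> 0 < (expmx A x *m G) i 0.
Proof.
move=> A0 G0 x0; pose c := \sum_a `|A a a|.
rewrite -(pmulr_rgt0 _ (expR_gt0 (c * x))) -expmx_shift.
apply: (lt_le_trans (G0 i)); apply: expmx_ge1 => // [a b|j]; last exact: ltW.
rewrite !mxE; have [<-|ab] := eqVneq a b; last by rewrite mulr0n addr0 A0.
rewrite mulr1n addrC -lerBlDr sub0r (le_trans (ler_norm _))// normrN.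
by rewrite /c (bigD1 a)//= lerDl sumr_ge0.
Qed.

End MetzlerPositivity.

(** * Integration by parts for absolutely continuous functions *)

Section ByParts.
Variable R : realType.
Notation mu := (@lebesgue_measure R).
Variables (a b : R).
Hypothesis ab : a <= b.
Implicit Types (h k H K : R -> R).

(** [H] is absolutely continuous on [[a, b]] with integrable derivative [h], in
    integral form: this is how the forward equation of the chain is given. *)
Definition primitive_on h H :=
  mu.-integrable `[a, b] (EFin \o h) /\
  forall x, x \in `[a, b] -> H x = H a + \int[mu]_(u in `[a, x]) h u.

Lemma primitive_continuous h H : primitive_on h H ->
  {within `[a, b], continuous H}.
Proof.
move=> [ih Hh].
have : {within `[a, b], continuous (fun x => H a + parameterized_integral mu a x h)}.
  move=> x; apply: cvgD; first exact: cvg_cst.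
  exact: parameterized_integral_continuous.
apply: subspace_eq_continuous => x.
rewrite inE /= => xab. exact: esym (Hh x xab).
Qed.

Lemma primitive_sub h H x : primitive_on h H -> x \in `[a, b] ->
  \int[mu]_(u in `[x, b]) h u = H b - H x.
Proof.
move=> [ih Hh] xab.
have /andP[ax xb] : a <= x <= b by move: xab; rewrite in_itv.
rewrite (Hh x)// (Hh b) ?in_itv/= ?ab ?lexx// opprD addrACA subrr add0r.
rewrite (Rintegral_itvB ih) ?bnd_simp// Rintegral_itv_obnd_cbnd//.
apply: integrableS ih => // z /=; rewrite !in_itv/= => /andP[xz ->].
by rewrite (le_trans ax (ltW xz)).
Qed.

Lemma integrable_mul_primitive h k H : mu.-integrable `[a, b] (EFin \o k) ->
  primitive_on h H -> mu.-integrable `[a, b] (EFin \o (fun x => H x * k x)).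
Proof.
move=> ik Hh; have cH := primitive_continuous Hh.
have -> : EFin \o (fun x => H x * k x) = ((EFin \o H) \* (EFin \o k))%E.
  by apply/funext => x /=; rewrite EFinM.
apply: integrableMr => //.
- exact: subspace_continuous_measurable_fun.
- have /compact_bounded[M [Mr MH]] :=
    continuous_compact cH (@segment_compact _ a b).
  exists M; split => // N MN x abx; apply: (MH N MN).
  by exists x.
Qed.

(** With [f (s, v) = h s * k v] on the triangle [s <= v] of the square, integrating
    first in [v] gives [\int h (K b - K)], and first in [s] gives [\int k (H - H a)].
    Fubini's theorem identifies the two. *)
Lemma primitive_by_parts h k H K : primitive_on h H -> primitive_on k K ->
  \int[mu]_(x in `[a, b]) (H x * k x + K x * h x) = H b * K b - H a * K a.
Proof.
move=> Hh Kk; have [ih _] := Hh; have [ik _] := Kk.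
pose D : set R := `[a, b]%classic.
have mD : measurable D by exact: measurable_itv.
pose h1 := h \_ D; pose k1 := k \_ D.
pose le2 : set (R * R) := [set z | z.1 <= z.2].
have mle2 : measurable le2.
  rewrite -[X in measurable X]setTI.
  exact: measurable_fun_le.
pose f (z : R * R) : \bar R := (h1 z.1 * k1 z.2 * \1_le2 z)%:E.
have ih1 : mu.-integrable setT (EFin \o h1).
  have := (integrable_restrict mu mD measurableT (EFin \o h)).1.
  by rewrite setTI restrict_EFin; exact.
have ik1 : mu.-integrable setT (EFin \o k1).
  have := (integrable_restrict mu mD measurableT (EFin \o k)).1.
  by rewrite setTI restrict_EFin; exact.
have mh1 : measurable_fun setT h1 by apply/measurable_EFinP; case/integrableP : ih1.
have mk1 : measurable_fun setT k1 by apply/measurable_EFinP; case/integrableP : ik1.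
have mah : measurable_fun setT (fun s => `|(h1 s)%:E|)%E.
  exact: (measurableT_comp (@abse_measurable R setT)
    (measurableT_comp (@EFin_measurable R setT) mh1)).
have mak : measurable_fun setT (fun s => `|(k1 s)%:E|)%E.
  exact: (measurableT_comp (@abse_measurable R setT)
    (measurableT_comp (@EFin_measurable R setT) mk1)).
have mf : measurable_fun setT f.
  apply/measurable_EFinP; apply: measurable_funM; last exact: measurable_indic.
  by apply: measurable_funM; [exact: (measurableT_comp mh1 measurable_fst)|
                              exact: (measurableT_comp mk1 measurable_snd)].
have intf : (mu \x mu)%E.-integrable setT f.
  apply/integrable12ltyP => //.
  have k1fin : (\int[mu]_v `|(k1 v)%:E| < +oo)%E by case/integrableP : ik1.
  have h1fin : (\int[mu]_v `|(h1 v)%:E| < +oo)%E by case/integrableP : ih1.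
  apply: (@le_lt_trans _ _
    (\int[mu]_s ((\int[mu]_v `|(k1 v)%:E|) * `|(h1 s)%:E|))%E).
    apply: ge0_le_integral => //.
    - by move=> s _; apply: integral_ge0.
    - apply: (@measurable_fun_fubini_tonelli_F _ _ _ _ _ mu (abse \o f)) => //=.
      exact: measurableT_comp.
    - exact: emeasurable_funM (measurable_cst _) mah.
    - move=> s _; rewrite muleC -ge0_integralZl//.
      apply: ge0_le_integral => //.
      + exact: (measurableT_comp (@abse_measurable R setT) (measurable_fun_pair2 s mf)).
      + exact: emeasurable_funM (measurable_cst _) mak.
      + move=> v _; rewrite /f/= lee_fin !normrM ler_piMr ?mulr_ge0//.
        by rewrite indicE; case: (_ \in _); rewrite ?normr1 ?normr0.
  rewrite ge0_integralZl//; last exact: integral_ge0.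
  apply: lte_mul_pinfty => //; first exact: integral_ge0.
  by rewrite ge0_fin_numE// integral_ge0.
have := Fubini intf.
have Ff s : (\int[mu]_v f (s, v) = ((fun s => h s * (K b - K s)) \_ D s)%:E)%E.
  rewrite patchE; case: ifPn => [sD|sD]; last first.
    apply: integral0_eq => v _; rewrite /f/= /h1 patchE (negbTE sD) !mul0r//.
  have sab : s \in `[a, b] by move: sD; rewrite inE.
  rewrite -(primitive_sub Kk sab).
  have iks : mu.-integrable `[s, b] (EFin \o k).
    apply: integrableS ik => //; apply: subset_itvr.
    by move: sab; rewrite in_itv/= bnd_simp => /andP[].
  have -> : (h s * \int[mu]_(u in `[s, b]) k u)%:E =
      (\int[mu]_(v in `[s, b]) ((h s)%:E * (k v)%:E))%E.
    by rewrite integralZl// EFinM /Rintegral fineK// integrable_fin_num.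
  rewrite [RHS]integral_mkcond; apply: eq_integral => v _.
  rewrite patchE /f/= /h1 /k1 !patchE sD.
  rewrite indicE (_ : ((s, v) \in le2) = (s <= v)); last first.
    by apply/idP/idP; rewrite inE.
  rewrite (_ : (v \in `[s, b]%classic) = (v \in D) && (s <= v)); last first.
    move: sab; rewrite in_itv/= => /andP[sa _].
    apply/idP/andP; rewrite /D !inE/= !in_itv/=.
      by move=> /andP[sv ->]; rewrite sv (le_trans sa sv).
    by move=> [/andP[_ ->] ->].
  by case: (v \in D); case: (s <= v); rewrite /= ?mulr1 ?mulr0 ?mul0r.
have Gf v : (\int[mu]_s f (s, v) = ((fun v => k v * (H v - H a)) \_ D v)%:E)%E.
  rewrite patchE; case: ifPn => [vD|vD]; last first.
    by apply: integral0_eq => s _; rewrite /f/= /k1 patchE (negbTE vD) mulr0 mul0r.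
  have vab : v \in `[a, b] by move: vD; rewrite inE.
  have -> : H v - H a = \int[mu]_(u in `[a, v]) h u.
    by rewrite (Hh.2 v)// addrAC subrr add0r.
  have ihv : mu.-integrable `[a, v] (EFin \o h).
    apply: integrableS ih => //; apply: subset_itvl.
    by move: vab; rewrite in_itv/= bnd_simp => /andP[].
  have -> : (k v * \int[mu]_(u in `[a, v]) h u)%:E =
      (\int[mu]_(s in `[a, v]) ((k v)%:E * (h s)%:E))%E.
    by rewrite integralZl// EFinM /Rintegral fineK// integrable_fin_num.
  rewrite [RHS]integral_mkcond; apply: eq_integral => s _.
  rewrite patchE /f/= /h1 /k1 !patchE vD.
  rewrite indicE (_ : ((s, v) \in le2) = (s <= v)); last first.
    by apply/idP/idP; rewrite inE.
  rewrite (_ : (s \in `[a, v]%classic) = (s \in D) && (s <= v)); last first.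
    move: vab; rewrite in_itv/= => /andP[_ vb].
    apply/idP/andP; rewrite /D !inE/= !in_itv/=.
      by move=> /andP[-> sv]; rewrite sv (le_trans sv vb).
    by move=> [/andP[-> _] ->].
  by case: (s \in D); case: (s <= v); rewrite /= ?mulr1 ?mulr0 ?mul0r// mulrC.
have iKh := integrable_mul_primitive ih Kk.
have iHk := integrable_mul_primitive ik Hh.
under eq_integral do rewrite Ff.
under [in RHS]eq_integral do rewrite Gf.
move=> /(congr1 fine); rewrite -/(Rintegral _ _ _) -/(Rintegral _ _ _).
rewrite -!Rintegral_mkcond => E.
have iKbh : mu.-integrable D (EFin \o (fun s => K b * h s)).
  exact: (@integrableZl _ _ _ mu D mD (K b) (EFin \o h) ih).
have iHak : mu.-integrable D (EFin \o (fun s => H a * k s)).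
  exact: (@integrableZl _ _ _ mu D mD (H a) (EFin \o k) ik).
have E1 : \int[mu]_(s in D) (h s * (K b - K s)) =
    K b * (H b - H a) - \int[mu]_(s in D) (K s * h s).
  have aab : a \in `[a, b] by rewrite in_itv/= lexx ab.
  rewrite -(primitive_sub Hh aab) -RintegralZl// -RintegralB//.
  by apply: eq_Rintegral => s _; ring.
have E2 : \int[mu]_(v in D) (k v * (H v - H a)) =
    \int[mu]_(s in D) (H s * k s) - H a * (K b - K a).
  have aab : a \in `[a, b] by rewrite in_itv/= lexx ab.
  rewrite -(primitive_sub Kk aab) -RintegralZl// -RintegralB//.
  by apply: eq_Rintegral => s _; ring.
rewrite RintegralD//.
move: E; rewrite E1 E2 => E.
lra.
Qed.

End ByParts.

Section Primitive.
Variable R : realType.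

Lemma is_derive_primitive_on (a b : R) (f F : R -> R) : a <= b ->
  (forall x, x \in `[a, b] -> is_derive x (1 : R) F (f x)) ->
  (forall x, x \in `[a, b] -> {for x, continuous f}) ->
  primitive_on a b f F.
Proof.
move=> ab dF cf.
have cfw x y : a <= x -> y <= b -> {within `[x, y], continuous f}.
  move=> ax yb; apply/subspace_continuousP => z /=; rewrite in_itv/= => /andP[xz zy].
  apply: cvg_within_filter; apply: cf.
  by rewrite in_itv/= (le_trans ax xz) (le_trans zy yb).
split.
  by apply: continuous_compact_integrable; [exact: segment_compact|exact: cfw].
move=> x; rewrite in_itv/= => /andP[]; rewrite le_eqVlt => /predU1P[<-|ax] xb.
  by rewrite set_itv1 Rintegral_set1 addr0.
have cF z : a <= z -> z <= b -> {for z, continuous F}.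
  move=> az zb; apply: differentiable_continuous; apply/derivable1_diffP.
  by have [] := dF z; rewrite ?in_itv/= ?az.
have := @continuous_FTC2 R f F a x ax (cfw _ _ (lexx a) xb).
rewrite /Rintegral => ->; first by rewrite -EFinB/= addrC subrK.
  split.
  - move=> z; rewrite in_itv/= => /andP[az zx].
    by have [] := dF z; rewrite ?in_itv/= ?(ltW az) ?(le_trans (ltW zx)).
  - by apply: cvg_at_right_filter; apply: cF.
  - by apply: cvg_at_left_filter; apply: cF => //; exact: ltW.
move=> z; rewrite in_itv/= => /andP[az zx]; rewrite derive1E.
by have := dF z; rewrite in_itv/= (ltW az) (le_trans (ltW zx))// => /(_ isT)[].
Qed.

End Primitive.

(** * Integrals of an integrable function plus or minus a nonnegative one *)

Section IntegralShift.
Context {d : measure_display} {S : measurableType d} {R : realType}.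
Variable nu : {measure set S -> \bar R}.
Variables (D : set S) (mD : measurable D) (h : S -> R) (c : S -> \bar R).
Hypothesis ih : nu.-integrable D (EFin \o h).
Hypothesis mc : measurable_fun D c.
Hypothesis c0 : forall x, D x -> (0 <= c x)%E.

Let F x : \bar R := (c x + (h x)%:E)%E.

Let mh : measurable_fun D (EFin \o h). Proof. by case/integrableP : ih. Qed.

Let mF : measurable_fun D F. Proof. exact: emeasurable_funD. Qed.

Let iabsh : (\int[nu]_(x in D) `|(h x)%:E| < +oo)%E.
Proof. by case/integrableP : ih. Qed.

Let mabsh : measurable_fun D (fun x => `|(h x)%:E|)%E.
Proof. exact: (measurableT_comp (@abse_measurable R setT) mh). Qed.

(** Since [c] is nonnegative, the negative part of the sum is dominated by
    the absolute value of [h]. *)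
Lemma integralD_ge0l_neg : (\int[nu]_(x in D) ((fun x => c x + (h x)%:E)^\- x) < +oo)%E.
Proof.
rewrite -/F; apply: le_lt_trans iabsh; apply: ge0_le_integral => //.
- exact: measurable_funeneg.
- move=> x Dx; rewrite funenegE ge_max abse_ge0 andbT /F.
  have := c0 Dx; case: (c x) => [r| |]//=; rewrite ?leNye// !lee_fin => r0.
  by rewrite opprD -[leRHS]add0r lerD ?oppr_le0// -normrN ler_norm.
Qed.

(** If the integral of [c] is infinite then so is that of the positive part of the
    sum, as [c] is at most this positive part plus the absolute value of [h]; the
    negative part has a finite integral. *)
Lemma integralD_ge0l :
  (\int[nu]_(x in D) (c x + (h x)%:E) =
   \int[nu]_(x in D) c x + \int[nu]_(x in D) (h x)%:E)%E.
Proof.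
have [coo|] := ltP (\int[nu]_(x in D) c x)%E +oo%E.
  apply: integralD => //; apply/integrableP; split => //.
  by under eq_integral => x /[!inE] Dx do rewrite gee0_abs ?c0//.
rewrite leye_eq => /eqP coo; rewrite coo addye; last first.
  by have /fin_numP[] := integrable_fin_num mD ih.
have Fnegfin : (\int[nu]_(x in D) (F^\- x) \is a fin_num)%E.
  by rewrite ge0_fin_numE ?integral_ge0//; exact: integralD_ge0l_neg.
rewrite integralE.
suff -> : (\int[nu]_(x in D) (F^\+ x) = +oo)%E.
  by rewrite addye//; move: Fnegfin; rewrite -fin_numN => /fin_numP[].
have mFp : measurable_fun D (F^\+)%E by exact: measurable_funepos.
apply/eqP; rewrite -leye_eq -coo leNgt; apply/negP => Flt.
have : (\int[nu]_(x in D) c x <= \int[nu]_(x in D) (F^\+ x + `|(h x)%:E|))%E.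
  apply: ge0_le_integral => //; first exact: emeasurable_funD.
  move=> x Dx; rewrite funeposE /F.
  have : (c x + (h x)%:E <= maxe (c x + (h x)%:E) 0)%E by rewrite le_max lexx.
  move=> /(leeD2r `|(h x)%:E|)%E; apply: le_trans.
  rewrite -addeA -[leLHS]adde0 leeD2l//= lee_fin -lerBlDl sub0r -normrN ler_norm//.
rewrite ge0_integralD// leNgt => /negP; apply.
by rewrite coo in Flt *; exact: lte_add_pinfty.
Qed.

End IntegralShift.

Lemma integralB_ge0r d (S : measurableType d) (R : realType)
  (nu : {measure set S -> \bar R}) (D : set S) (mD : measurable D)
  (h : S -> R) (c : S -> \bar R) : nu.-integrable D (EFin \o h) ->
  measurable_fun D c -> (forall x, D x -> (0 <= c x)%E) ->
  (\int[nu]_(x in D) ((h x)%:E - c x) =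
   \int[nu]_(x in D) (h x)%:E - \int[nu]_(x in D) c x)%E.
Proof.
move=> ih mc c0.
have ihN : nu.-integrable D (EFin \o (fun x => - h x)).
  exact: (integrableN ih).
have hN : (\int[nu]_(x in D) (- h x)%:E = - \int[nu]_(x in D) (h x)%:E)%E.
  by rewrite -integralN// ; exact: integrable_add_def.
transitivity (\int[nu]_(x in D) - (c x + (- h x)%:E))%E.
  apply: eq_integral => x; rewrite inE => Dx.
  case: (c x) (c0 x Dx) => [r| |] //= _; congr EFin; ring.
rewrite integralN; last first.
  rewrite fin_num_adde_defl// fin_numN ge0_fin_numE ?integral_ge0//.
  exact: integralD_ge0l_neg.
rewrite integralD_ge0l// hN oppeD ?oppeK 1?addeC//.
by rewrite fin_num_adde_defl// fin_numN integrable_fin_num.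
Qed.

(** * Right-continuous processes with values in a finite set *)

Section JointMeasurability.
Context {R : realType} {d : measure_display} {Omega : measurableType d}.

Lemma at_right_itv (s : R) (Q : R -> Prop) : (\forall u \near s^'+, Q u) ->
  exists2 e, 0 < e & forall u, s < u < s + e -> Q u.
Proof.
rewrite near_withinE => /nbhs_ballP[e /= e0 eQ]; exists e => // u /andP[su ue].
apply: (eQ u) => //=; rewrite /ball/= ltr_norml; apply/andP; split; lra.
Qed.

Variables (S : choiceType) (X : R -> Omega -> S) (t T : R).
Hypothesis tT : t <= T.
Hypothesis mX : forall s, t <= s <= T ->
  forall k, measurable (X s @^-1` [set k]).
Hypothesis rcX : forall w s, t <= s < T -> \forall u \near s^'+, X u w = X s w.

Definition occupation k : set (R * Omega) :=
  [set z | z.1 \in `[t, T] /\ X z.1 z.2 = k].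

(** For [s < T], right-continuity and density of the rationals give: [X s w = k] if
    and only if there is a rational [q0 > s] such that [X q w = k] for every
    rational [q] with [s < q < q0] and [q <= T].  This only involves countable
    operations on measurable rectangles. *)
Lemma measurable_occupation k : measurable (occupation k).
Proof.
pose C (q0 q : rat) : set (R * Omega) :=
  if (t <= ratr q <= T) && (q < q0) then
    ([set s | (ratr q : R) <= s] `*` setT) `|` (setT `*` (X (ratr q) @^-1` [set k]))
  else setT.
pose A (q0 : rat) : set (R * Omega) :=
  ([set s | t <= s < T /\ s < ratr q0] `*` setT) `&` \bigcap_q C q0 q.
have -> : occupation k = ([set T] `*` (X T @^-1` [set k])) `|` \bigcup_q0 A q0.
  apply/seteqP; split => [[s w]|[s w]] /=.
    move=> /= [/= sT Xk]; have /andP[ts] : t <= s <= T by move: sT; rewrite in_itv.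
    rewrite le_eqVlt => /predU1P[sT'|sltT]; first by left; rewrite -sT'.
    right; have tsT : t <= s < T by rewrite ts.
    have [e e0 eX] := at_right_itv (rcX w tsT).
    have : s < s + e by rewrite ltrDl.
    move=> /rat_in_itvoo[q0]; rewrite in_itv/= => /andP[sq0 q0e].
    exists q0 => //; split => /=; first by [].
    move=> q _; rewrite /C; case: ifP => // /andP[_ qq0].
    have [qs|sq] := leP (ratr q : R) s; [left => //|right; split => //=].
    by rewrite eX// sq (lt_trans _ q0e)// ltr_rat.
  move=> [[-> XT]|[q0 _ [/= [[tsT sq0] _] Cq]]].
    by split => //=; rewrite in_itv/= tT lexx.
  have /andP[ts sT] := tsT; split => /=; first by rewrite in_itv/= ts ltW.
  have [e e0 eX] := at_right_itv (rcX w tsT).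
  have : s < Num.min (s + e) (Num.min (ratr q0) T).
    by rewrite !lt_min sq0 sT ltrDl e0.
  move=> /rat_in_itvoo[q]; rewrite in_itv/= !lt_min => /and3P[sq qe /andP[qq0 qT]].
  have := Cq q I; rewrite /C (le_trans ts (ltW sq)) (ltW qT)/=.
  rewrite -(ltr_rat R) qq0 => -[/= [qs _]|/= [_ <-]].
    by move: sq; rewrite ltNge qs.
  by rewrite eX// sq.
apply: measurableU.
  by apply: measurableX => //; apply: mX; rewrite tT lexx.
apply: bigcupT_measurable_rat => q0; apply: measurableI.
  apply: measurableX => //.
  rewrite (_ : [set s | _] = `[t, T[%classic `&` `]-oo, (ratr q0 : R)[%classic).
    exact: measurableI.
  by apply/seteqP; split => s /=; rewrite !in_itv.
rewrite -[X in measurable X]setCK setC_bigcap; apply: measurableC.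
apply: bigcupT_measurable_rat => q; apply: measurableC; rewrite /C.
case: ifPn => // /andP[tqT _]; apply: measurableU; apply: measurableX => //.
  rewrite (_ : [set s | _] = `[(ratr q : R), +oo[%classic) //.
  by apply/seteqP; split => s /=; rewrite in_itv/= andbT.
exact: mX.
Qed.

End JointMeasurability.

Section OccupationTonelli.
Context {R : realType} {d : measure_display} {Omega : measurableType d}.
Variable P : probability Omega R.
Notation mu := (@lebesgue_measure R).
Variables (I : finType) (X : R -> Omega -> I) (t T : R).
Hypothesis tT : t <= T.
Hypothesis mX : forall s, t <= s <= T ->
  forall k, measurable (X s @^-1` [set k]).
Hypothesis rcX : forall w s, t <= s < T -> \forall u \near s^'+, X u w = X s w.
Variables (c : I -> R -> R) (m : I -> R -> R).
Hypothesis mc : forall k, measurable_fun `[t, T] (c k).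
Hypothesis c0 : forall k s, s \in `[t, T] -> 0 <= c k s.
Hypothesis mE : forall k s, s \in `[t, T] -> P (X s @^-1` [set k]) = (m k s)%:E.

Let D : set R := `[t, T]%classic.
Let f (z : R * Omega) : \bar R :=
  (\sum_k (c k \_ D) z.1 * \1_(occupation X t T k) z)%:E.

Let c0' k s : 0 <= (c k \_ D) s.
Proof. by rewrite patchE; case: ifPn => //; rewrite inE => /c0. Qed.

Let mD : measurable D. Proof. exact: measurable_itv. Qed.

Let mf : measurable_fun setT f.
Proof.
apply/measurable_EFinP; apply: measurable_sum => k; apply: measurable_funM.
  apply: (@measurableT_comp _ _ _ _ _ _ (c k \_ D) setT fst) => //.
  exact: (measurable_restrictT _ mD).1.
by apply: measurable_indic; exact: measurable_occupation.
Qed.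

Let f0 z : (0 <= f z)%E.
Proof. by rewrite lee_fin sumr_ge0// => k _; rewrite mulr_ge0. Qed.

Let f_sum s w : \sum_k (c k \_ D) s * \1_(occupation X t T k) (s, w) =
  if s \in D then c (X s w) s else 0.
Proof.
under eq_bigr do rewrite patchE indicE.
case: ifPn => sD; last first.
  by rewrite big1// => k _; rewrite mul0r.
rewrite (bigD1 (X s w))//= mem_set ?mulr1; last by split=> //; rewrite -inE.
rewrite big1 ?addr0// => k kX; rewrite memNset ?mulr0//= => -[_ Xk].
by rewrite Xk eqxx in kX.
Qed.

Let f_int w : (\int[mu]_s f (s, w) = \int[mu]_(s in D) (c (X s w) s)%:E)%E.
Proof.
rewrite [RHS]integral_mkcond; apply: eq_integral => s _.
by rewrite patchE /f/= f_sum; case: ifP.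
Qed.

Lemma measurable_running_integral :
  measurable_fun setT (fun w => \int[mu]_(s in D) (c (X s w) s)%:E)%E.
Proof.
under eq_fun do rewrite -f_int.
exact: (@measurable_fun_fubini_tonelli_G _ _ _ _ _ mu f).
Qed.

Lemma measurable_running_cost w :
  measurable_fun D (fun s => (c (X s w) s)%:E).
Proof.
have := measurable_funTS (measurable_fun_pair1 w mf) (D := D).
apply: eq_measurable_fun => s sD; rewrite /f/=; congr EFin.
by rewrite f_sum sD.
Qed.

Lemma expectation_running_integral :
  (\int[P]_w \int[mu]_(s in D) (c (X s w) s)%:E =
   \int[mu]_(s in D) (\sum_k m k s * c k s)%:E)%E.
Proof.
under eq_integral do rewrite -f_int.
rewrite -(@fubini_tonelli _ _ _ _ _ mu P f)//.
rewrite [RHS]integral_mkcond; apply: eq_integral => s _; rewrite patchE.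
case: ifPn => sD; last first.
  apply: integral0_eq => w _; rewrite /f/= big1// => k _.
  by rewrite patchE (negbTE sD) mul0r.
have stT : s \in `[t, T] by move: sD; rewrite inE.
have st : t <= s <= T by move: stT; rewrite in_itv.
transitivity (\int[P]_w (\sum_k (c k s)%:E * (\1_(X s @^-1` [set k]) w)%:E))%E.
  apply: eq_integral => w _; rewrite /f/= -sumEFin; apply: eq_bigr => k _.
  rewrite patchE sD EFinM; congr (_ * (_)%:E)%E; rewrite !indicE; congr (_%:R).
  by congr nat_of_bool; apply/idP/idP; rewrite !inE/=; [case|split].
rewrite ge0_integral_sum//; last 2 first.
  move=> k; apply: emeasurable_funM => //; apply/measurable_EFinP.
  by apply: measurable_indic; exact: mX.
  by move=> k w _; rewrite mule_ge0// lee_fin ?c0.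
rewrite -sumEFin; apply: eq_bigr => k _.
rewrite ge0_integralZl//; last 2 first.
  by apply/measurable_EFinP; apply: measurable_indic; exact: mX.
  by rewrite lee_fin c0.
rewrite integral_indic//; last exact: mX.
by rewrite setIT mulrC EFinM; congr (_ * _)%E; exact: mE.
Qed.

End OccupationTonelli.

Lemma expectation_finite_range {R : realType} {d : measure_display}
  {Omega : measurableType d} (P : probability Omega R) (I : finType)
  (Y : Omega -> I) (phi q : I -> R) :
  (forall k, measurable (Y @^-1` [set k])) ->
  (forall k, P (Y @^-1` [set k]) = (q k)%:E) ->
  P.-integrable setT (fun w => (phi (Y w))%:E) /\
  (\int[P]_w (phi (Y w))%:E = (\sum_k q k * phi k)%:E)%E.
Proof.
move=> mY qE.
have phiE w : ((phi (Y w))%:E =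
    \sum_k (phi k)%:E * (\1_(Y @^-1` [set k]) w)%:E)%E.
  rewrite (bigD1 (Y w))//= indicE mem_set// mule1 big1 ?adde0// => k kY.
  by rewrite indicE memNset ?mule0//= => Yk; rewrite Yk eqxx in kY.
have i1 k : P.-integrable setT (fun w => (\1_(Y @^-1` [set k]) w)%:E).
  exact: integrable_indic.
have ik k : P.-integrable setT (fun w => (phi k)%:E * (\1_(Y @^-1` [set k]) w)%:E)%E.
  exact: integrableZl.
split.
  by under eq_fun do rewrite phiE; exact: integrable_sum.
under eq_integral do rewrite phiE.
rewrite integral_sum// -sumEFin; apply: eq_bigr => k _.
rewrite integralZl// integral_indic// setIT mulrC EFinM; congr (_ * _)%E.
exact: qE.
Qed.

(** * The logarithm of w and the Hamilton-Jacobi-Bellman equation *)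

Section Young.
Variable R : realType.
Implicit Types (l b x : R).

(** Fenchel's inequality between the relative entropy of a Poisson intensity and
    the exponential; for [0 < l] it amounts to [ln y <= y - 1] at
    [y = b x / l]. *)
Lemma poisson_young l b x : 0 <= l -> 0 < b -> 0 < x ->
  l * ln x - b * (x - 1) <= l * ln (l / b) + b - l.
Proof.
rewrite le_eqVlt => /predU1P[<-|l0] b0 x0.
  by rewrite !mul0r; have := mulr_gt0 b0 x0; lra.
have y0 : 0 < b * x / l by rewrite divr_gt0// mulr_gt0.
have : ln (b * x / l) <= b * x / l - 1.
  by rewrite -[X in ln X](subrKC 1) le_ln1Dx// ltrBrDl subrr.
have -> : ln (b * x / l) = ln x - ln (l / b).
  by rewrite !lnM ?lnV ?posrE ?invr_gt0 ?mulr_gt0//; ring.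
move=> /(ler_wpM2l (ltW l0)); rewrite [leRHS]mulrBr mulr1.
rewrite [l * (_ / l)]mulrC divfK ?gt_eqF//.
lra.
Qed.

(** The case of equality [y = 1], that is [l = b x]. *)
Lemma poisson_young_eq b x : 0 < b -> 0 < x ->
  b * x * ln x - b * (x - 1) = b * x * ln (b * x / b) + b - b * x.
Proof.
by move=> b0 x0; rewrite [b * x / b]mulrAC divff ?gt_eqF// mul1r; ring.
Qed.

End Young.

Section ValueFunction.
Context {R : realType} {N : nat}.
Variables (V : 'I_N -> {set 'I_N}) (hV : forall i, i \notin V i).
Variables (r g : 'I_N -> R) (lbar : 'I_N -> 'I_N -> R).
Hypothesis hlbar : forall i j, j \in V i -> 0 < lbar i j.
Variable T : R.

(** The rows of a generator sum to zero, and [k] is not its own successor. *)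
Lemma generator_mulE (rate : 'I_N -> 'I_N -> R) (v : 'I_N -> R) k :
  \sum_j generator V rate k j * v j = \sum_(j in V k) rate k j * (v j - v k).
Proof.
rewrite (bigD1 k)//= mxE (negbTE (hV k)) eqxx mulNr mulr_suml.
under [RHS]eq_bigr do rewrite mulrBr.
rewrite sumrB addrC; congr (_ - _).
rewrite [RHS]big_mkcond [RHS](bigD1 k)//= (negbTE (hV k)) add0r.
apply: eq_bigr => j jk; rewrite mxE (negbTE jk).
by case: ifP => // _; rewrite mul0r.
Qed.

Let W k s := wvec V r g lbar T s k 0.

Let WE k s : W k s = (expmx (matB V r lbar) (T - s) *m \col_i expR (g i)) k 0.
Proof. by rewrite /W /wvec mxexpE. Qed.

Lemma wvec_gt0 k s : s <= T -> 0 < W k s.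
Proof.
move=> sT; rewrite WE; apply: expmx_metzler_gt0.
- move=> a b ab; rewrite !mxE (negbTE ab) mulr0n add0r.
  case: ifPn => [/hlbar/ltW//|_].
  by rewrite eq_sym (negbTE ab).
- by move=> j; rewrite mxE expR_gt0.
- by rewrite subr_ge0.
Qed.

Lemma wvecT k : W k T = expR (g k).
Proof. by rewrite WE subrr expmx0 mul1mx mxE. Qed.

Lemma is_derive_wvec k s : is_derive s (1 : R) (W k)
  (- (r k * W k s + \sum_(j in V k) lbar k j * (W j s - W k s))).
Proof.
have h : is_derive s (1 : R) (fun s => T - s) (-1).
  have := is_deriveB (is_derive_cst T s (1 : R)) (is_derive_id s (1 : R)).
  by move/is_derive_ext; apply=> //; rewrite sub0r.
have := @is_derive1_comp _
  (fun z => (expmx (matB V r lbar) z *m \col_i expR (g i)) k 0)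
  (fun s => T - s) s _ _ (is_derive_expmx_mul _ _ _ k) h.
move/is_derive_ext; apply=> [z|]; first by rewrite WE.
rewrite mulrN1; congr (- _); rewrite mulmxDl mxE mul_diag_mx mxE [_ 0 k]mxE.
rewrite -WE; congr (_ + _); rewrite mxE -generator_mulE.
by apply: eq_bigr => j _; rewrite WE.
Qed.

Lemma continuous_wvec k s : {for s, continuous (W k)}.
Proof.
apply: differentiable_continuous; apply/derivable1_diffP.
by have [] := is_derive_wvec k s.
Qed.

(** The derivative of [ln (w_k s)] in [s]. *)
Definition dlnw k s := - (r k + \sum_(j in V k) lbar k j * (W j s / W k s - 1)).

Lemma primitive_lnw t k : t <= T -> primitive_on t T (dlnw k) (fun s => ln (W k s)).
Proof.
move=> tT; apply: is_derive_primitive_on => // s; rewrite in_itv/= => /andP[_ sT].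
- have := is_derive1_comp (is_derive1_ln (wvec_gt0 k sT)) (is_derive_wvec k s).
  move/is_derive_ext; apply=> //.
  rewrite mulrN; congr (- _); rewrite mulrDr.
  have W0 : W k s != 0 by rewrite gt_eqF// wvec_gt0.
  rewrite [r k * _]mulrC mulKf//; congr (_ + _).
  rewrite mulr_sumr; apply: eq_bigr => j _; field; exact: W0.
- rewrite /dlnw; apply: cvgN; apply: cvgD; first exact: cvg_cst.
  apply: cvg_big => [|j _]; first exact: add_continuous.
  apply: cvgM; first exact: cvg_cst.
  apply: cvgB; last exact: cvg_cst.
  apply: cvgM; first exact: continuous_wvec.
  by apply: cvgV; [rewrite gt_eqF// wvec_gt0|exact: continuous_wvec].
Qed.

(** Take [x = 1] in [poisson_young]. *)
Lemma cost_ge k (l : 'I_N -> R) : (forall j, j \in V k -> 0 <= l j) ->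
  - r k <= cost V r lbar k l.
Proof.
move=> l0; rewrite /cost lerDl; apply: sumr_ge0 => j jk.
have := poisson_young (l0 j jk) (hlbar jk) ltr01.
by rewrite ln1 mulr0 subrr mulr0 subrr.
Qed.

Lemma cost_shift_ge0 k (l : 'I_N -> R) : (forall j, j \in V k -> 0 <= l j) ->
  0 <= cost V r lbar k l + \sum_a `|r a|.
Proof.
move=> l0; rewrite -lerBlDr sub0r; apply: le_trans (cost_ge l0).
rewrite lerN2 (le_trans (ler_norm _))// (bigD1 k)//= lerDl.
by apply: sumr_ge0.
Qed.

Lemma hjb_le k s (l : 'I_N -> R) : s <= T -> (forall j, j \in V k -> 0 <= l j) ->
  dlnw k s + \sum_(j in V k) l j * (ln (W j s) - ln (W k s)) <= cost V r lbar k l.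
Proof.
move=> sT l0; rewrite /dlnw /cost opprD -addrA lerD2l addrC -sumrB.
apply: ler_sum => j jk.
have := poisson_young (l0 j jk) (hlbar jk) (divr_gt0 (wvec_gt0 j sT) (wvec_gt0 k sT)).
by rewrite (@ln_div _ (W j s)) ?posrE ?wvec_gt0.
Qed.

Lemma hjb_eq k s : s <= T ->
  dlnw k s + \sum_(j in V k) opt_control V r g lbar T s k j *
    (ln (W j s) - ln (W k s)) = cost V r lbar k (opt_control V r g lbar T s k).
Proof.
move=> sT; rewrite /dlnw /cost opprD -addrA; congr (_ + _); rewrite addrC -sumrB.
apply: eq_bigr => j jk; rewrite /opt_control -/(W j s) -/(W k s).
rewrite -poisson_young_eq ?hlbar// ?divr_gt0 ?wvec_gt0//.
by rewrite (@ln_div _ (W j s)) ?posrE ?wvec_gt0.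
Qed.

Lemma admissible_opt_control t : t <= T -> admissible V T t (opt_control V r g lbar T).
Proof.
move=> tT i j ij; split.
  move=> s; rewrite in_itv/= => /andP[_ sT].
  by rewrite mulr_ge0 ?divr_ge0// ltW ?hlbar ?wvec_gt0.
apply: continuous_compact_integrable; first exact: segment_compact.
apply/subspace_continuousP => s /=; rewrite in_itv/= => /andP[_ sT].
apply: cvg_within_filter; apply: cvgM; first exact: cvg_cst.
apply: cvgM; first exact: continuous_wvec.
by apply: cvgV; [rewrite gt_eqF// wvec_gt0|exact: continuous_wvec].
Qed.

End ValueFunction.

(** * The criterion as the value minus an expected gap *)

Section Marginals.
Context {R : realType} {N : nat} {d : measure_display} {Omega : measurableType d}.
Variables (P : probability Omega R) (V : 'I_N -> {set 'I_N}).
Variables (T : R) (F : R -> set (set Omega)) (hF : usual_filtration P T F).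
Variables (t : R) (ht : 0 <= t <= T) (i : 'I_N) (lam : R -> 'I_N -> 'I_N -> R).
Variable X : R -> Omega -> 'I_N.
Hypothesis hX : markov_chain P V F T t i lam X.

Lemma chain_measurable s k : t <= s <= T -> measurable (X s @^-1` [set k]).
Proof.
move=> /andP[ts sT]; have /andP[t0 _] := ht.
apply: (filtration_measurable hF (t := s)); first by rewrite sT (le_trans t0 ts).
by apply: (chain_adapted hX); rewrite ts.
Qed.

(** The Markov property with conditioning time [t] and the sure event; the
    chain is at [i] at time [t] up to a null event. *)
Lemma chain_marginal : exists2 p, transition_matrices V T t lam p &
  forall s k, s \in `[t, T] -> P (X s @^-1` [set k]) = (p t s i k)%:E.
Proof.
have [p hp hm] := chain_markov hX; exists p => // s k; rewrite in_itv/= => /andP[ts sT].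
have /andP[t0 tT] := ht.
have FT : F t setT.
  have [F0 FC _] := filtration_sigma_algebra hF ht.
  by rewrite -(setD0 setT); exact: FC.
have mt : measurable (X t @^-1` [set i]) by apply: chain_measurable; rewrite lexx.
have ms : measurable (X s @^-1` [set k]) by apply: chain_measurable; rewrite ts.
have := hm t s (lexx t) ts sT setT FT i k.
rewrite !setTI (chain_start hX) mul1e => <-.
rewrite [LHS](measureDI P ms mt) setIC [X in (X + _)%E](_ : _ = 0%E) ?add0e//.
apply: (@subset_measure0 _ _ _ P _ (~` (X t @^-1` [set i]))).
- exact: measurableD.
- exact: measurableC.
- by move=> w [].
- transitivity (1 - P (X t @^-1` [set i]))%E; first exact: probability_setC.
  by rewrite [X in (1 - X)%E](_ : _ = 1%E) ?subee//; exact: (chain_start hX).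
Qed.

End Marginals.

Section Verification.
Context {R : realType} {N : nat}.
Variables (V : 'I_N -> {set 'I_N}) (hV : forall i, i \notin V i).
Variables (r g : 'I_N -> R) (lbar : 'I_N -> 'I_N -> R).
Hypothesis hlbar : forall i j, j \in V i -> 0 < lbar i j.
Notation mu := (@lebesgue_measure R).
Variables (T t : R) (tT : t <= T) (i : 'I_N) (lam : R -> 'I_N -> 'I_N -> R).
Hypothesis hlam : admissible V T t lam.
Let W k s := wvec V r g lbar T s k 0.

(** What is lost at node [k] and time [s] by playing [lam] rather than the
    maximizer of the Hamiltonian. *)
Definition hjb_gap k s := cost V r lbar k (lam s k) -
  (dlnw V r g lbar T k s + \sum_(j in V k) lam s k j * (ln (W j s) - ln (W k s))).

Lemma hjb_gap_ge0 k s : s \in `[t, T] -> 0 <= hjb_gap k s.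
Proof.
move=> st; have /andP[_ sT] : t <= s <= T by move: st; rewrite in_itv.
by rewrite subr_ge0; apply: hjb_le => // j jk; exact: (hlam jk).1.
Qed.

Lemma measurable_cost k : measurable_fun `[t, T] (fun s => cost V r lbar k (lam s k)).
Proof.
rewrite (_ : (fun s => _) = (fun s => - r k + \sum_j (if j \in V k then
    lam s k j * ln (lam s k j / lbar k j) + lbar k j - lam s k j else 0))); last first.
  apply/funext => s; rewrite /cost; congr (_ + _).
  exact: big_mkcond.
apply: measurable_funD; first exact: measurable_cst.
apply: measurable_sum => j.
case: (boolP (j \in V k)) => [jk|_]; last exact: measurable_cst.
have ml : measurable_fun `[t, T] (fun s => lam s k j).
  by apply/measurable_EFinP; case/integrableP : (hlam jk).2.
apply: measurable_funB => //; apply: measurable_funD; last exact: measurable_cst.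
apply: measurable_funM => //; apply: (measurableT_comp (@measurable_ln R)).
by apply: measurable_funM => //; exact: measurable_cst.
Qed.

Variable p : R -> R -> 'M[R]_N.
Hypothesis hp : transition_matrices V T t lam p.

Let drift j s := (p t s *m generator V (lam s)) i j.

Lemma primitive_marginal j : primitive_on t T (drift j) (fun s => p t s i j).
Proof.
have [_ _ idp _] := hp (lexx t) tT (lexx T) i j; split; first exact: idp.
move=> s; rewrite in_itv/= => /andP[ts sT].
have [_ _ _ ->] := hp (lexx t) ts sT i j.
have [_ _ _ ->] := hp (lexx t) (lexx t) tT i j.
by rewrite set_itv1 Rintegral_set1 addr0.
Qed.

Lemma marginal_ge0 s k : s \in `[t, T] -> 0 <= p t s i k.
Proof. by rewrite in_itv/= => /andP[ts sT]; have [] := hp (lexx t) ts sT i k. Qed.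

Lemma marginal_sum s : s \in `[t, T] -> \sum_k p t s i k = 1.
Proof. by rewrite in_itv/= => /andP[ts sT]; have [] := hp (lexx t) ts sT i i. Qed.

(* The derivative in [s] of the expectation of [ln (w s)] at the position of the
   chain. *)
Let dyn s := \sum_k (p t s i k * dlnw V r g lbar T k s + ln (W k s) * drift k s).

(* The generator is moved from the marginals to [ln w] by transposition. *)
Let dynE s : dyn s = \sum_k p t s i k * (cost V r lbar k (lam s k) - hjb_gap k s).
Proof.
rewrite /dyn big_split/=.
have -> : \sum_k ln (W k s) * drift k s =
    \sum_k p t s i k * (\sum_(j in V k) lam s k j * (ln (W j s) - ln (W k s))).
  under [RHS]eq_bigr do
    rewrite -(generator_mulE hV (lam s) (fun j => ln (W j s))) mulr_sumr.
  rewrite exchange_big/=; apply: eq_bigr => j _; rewrite /drift mxE mulr_sumr.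
  by apply: eq_bigr => l _; ring.
by rewrite -big_split/=; apply: eq_bigr => k _; rewrite /hjb_gap; ring.
Qed.

Let integral_dyn : mu.-integrable `[t, T] (EFin \o dyn) /\
  \int[mu]_(s in `[t, T]) dyn s = \sum_k p t T i k * g k - ln (W i t).
Proof.
have pk k := primitive_marginal k.
have wk k := primitive_lnw hV r g hlbar k tT.
have i1 k := integrable_mul_primitive tT (wk k).1 (pk k).
have i2 k := integrable_mul_primitive tT (pk k).1 (wk k).
have i12 k : mu.-integrable `[t, T] (fun s =>
    (p t s i k * dlnw V r g lbar T k s + ln (W k s) * drift k s)%:E).
  exact: (@integrableD _ _ _ mu _ (measurable_itv _) _ _ (i1 k) (i2 k)).
have dE : EFin \o dyn = (fun s => \sum_k
    (p t s i k * dlnw V r g lbar T k s + ln (W k s) * drift k s)%:E)%E.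
  by apply/funext => s; rewrite /dyn/= sumEFin.
split; first by rewrite dE; exact: integrable_sum.
have -> : \int[mu]_(s in `[t, T]) dyn s = fine (\sum_k \int[mu]_(s in `[t, T])
    (p t s i k * dlnw V r g lbar T k s + ln (W k s) * drift k s)%:E)%E.
  rewrite -integral_sum//; congr fine.
  by apply: eq_integral => s _; rewrite sumEFin.
have tt : t \in `[t, T] by rewrite in_itv/= lexx tT.
have pti k : p t t i k = (i == k)%:R.
  have [_ _ _ ->] := hp (lexx t) (lexx t) tT i k.
  by rewrite set_itv1 Rintegral_set1 addr0.
transitivity (fine (\sum_k (p t T i k * g k - (i == k)%:R * ln (W k t))%:E)).
  congr fine; apply: eq_bigr => k _.
  rewrite -[LHS]fineK ?integrable_fin_num//; congr EFin.
  have := primitive_by_parts tT (pk k) (wk k).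
  by rewrite /W wvecT expRK pti => <-.
rewrite sumEFin/= sumrB; congr (_ - _).
rewrite (bigD1 i)//= eqxx mul1r big1 ?addr0// => k ki.
by rewrite eq_sym (negbTE ki) mul0r.
Qed.

Let C := \sum_k `|r k|.

(** The running cost is the gap plus the derivative of the expectation of [ln w];
    only the former can have an infinite integral, and it is nonnegative. *)
Lemma integral_expected_cost :
  (\int[mu]_(s in `[t, T]) (\sum_k p t s i k * (cost V r lbar k (lam s k) + C))%:E =
  \int[mu]_(s in `[t, T]) (\sum_k p t s i k * hjb_gap k s)%:E +
  (\sum_k p t T i k * (C * (T - t) + g k) - ln (W i t))%:E)%E.
Proof.
have [idyn dynI] := integral_dyn.
have mD : measurable (`[t, T]%classic : set R) by exact: measurable_itv.
have iC : mu.-integrable `[t, T] (EFin \o cst C).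
  apply: continuous_compact_integrable; first exact: segment_compact.
  by move=> ?; exact: cvg_cst.
have idC : mu.-integrable `[t, T] (EFin \o (fun s => dyn s + C)).
  have -> : EFin \o (fun s => dyn s + C) = (fun s => (dyn s)%:E + (cst C s)%:E)%E.
    by apply/funext => s; rewrite /= EFinD.
  exact: integrableD.
have mp k : measurable_fun `[t, T] (fun s => p t s i k).
  apply: subspace_continuous_measurable_fun => //.
  exact: (primitive_continuous tT (primitive_marginal k)).
have mdyn : measurable_fun `[t, T] dyn.
  by apply/measurable_EFinP; case/integrableP : idyn.
have gapE s : \sum_k p t s i k * hjb_gap k s =
    \sum_k p t s i k * cost V r lbar k (lam s k) - dyn s.
  by rewrite dynE -sumrB; apply: eq_bigr => k _; ring.
have mgap : measurable_fun `[t, T] (fun s => \sum_k p t s i k * hjb_gap k s).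
  rewrite (funext gapE).
  apply: measurable_funB => //; apply: measurable_sum => k.
  by apply: measurable_funM => //; exact: measurable_cost.
transitivity (\int[mu]_(s in `[t, T]) ((\sum_k p t s i k * hjb_gap k s)%:E +
    (dyn s + C)%:E))%E.
  apply: eq_integral => s; rewrite inE => st; congr EFin; rewrite gapE.
  under eq_bigr do rewrite mulrDr.
  by rewrite big_split/= -mulr_suml marginal_sum// mul1r; ring.
rewrite integralD_ge0l//; first last.
- move=> s st; rewrite lee_fin sumr_ge0// => k _.
  by rewrite mulr_ge0 ?marginal_ge0 ?hjb_gap_ge0.
- exact/measurable_EFinP.
congr (_ + _)%E.
have -> : (\int[mu]_(s in `[t, T]) (dyn s + C)%:E =
    (\int[mu]_(s in `[t, T]) (dyn s + C))%:E)%E.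
  by rewrite /Rintegral fineK// integrable_fin_num.
congr EFin; rewrite RintegralD// dynI.
rewrite Rintegral_cst//=. rewrite lebesgue_measure_itv/= lte_fin.
have -> : fine (if t < T then (T - t)%:E else 0%E) = T - t.
  by move: tT; rewrite le_eqVlt => /predU1P[->|->]//; rewrite ltxx subrr.
under [in RHS]eq_bigr do rewrite mulrDr.
rewrite big_split/= -mulr_suml marginal_sum; last by rewrite in_itv/= tT lexx.
by rewrite mul1r; ring.
Qed.

End Verification.

Section Criterion.
Context {R : realType} {N : nat} {d : measure_display} {Omega : measurableType d}.
Variables (P : probability Omega R) (V : 'I_N -> {set 'I_N}).
Hypothesis hV : forall i, i \notin V i.
Variables (r g : 'I_N -> R) (lbar : 'I_N -> 'I_N -> R).
Hypothesis hlbar : forall i j, j \in V i -> 0 < lbar i j.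
Notation mu := (@lebesgue_measure R).
Variables (T : R) (F : R -> set (set Omega)) (hF : usual_filtration P T F).
Variables (t : R) (ht : 0 <= t <= T) (i : 'I_N) (lam : R -> 'I_N -> 'I_N -> R).
Hypothesis hlam : admissible V T t lam.
Variable X : R -> Omega -> 'I_N.
Hypothesis hX : markov_chain P V F T t i lam X.

(** The identity holds in the extended reals: an infinite expected gap
    corresponds to the criterion being [-oo]. *)
Lemma criterion_gap : exists2 m : 'I_N -> R -> R,
  forall k s, s \in `[t, T] -> 0 <= m k s &
  criterion P V r g lbar T t lam X =
  ((ln (wvec V r g lbar T t i 0))%:E -
   \int[mu]_(s in `[t, T]) (\sum_k m k s * hjb_gap V r g lbar T lam k s)%:E)%E.
Proof.
have /andP[t0 tT] := ht.
have [p hp pE] := chain_marginal hF ht hX.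
exists (fun k s => p t s i k); first by move=> k s; exact: (marginal_ge0 i hp).
(* Costs are bounded below by [- C]. *)
pose C := \sum_k `|r k|.
pose c k s := cost V r lbar k (lam s k) + C.
have mX s (st : t <= s <= T) k := chain_measurable hF ht hX k st.
have rcX := chain_right_continuous hX.
have mc k : measurable_fun `[t, T] (c k).
  by apply: measurable_funD; [exact: measurable_cost|exact: measurable_cst].
have c0 k s : s \in `[t, T] -> 0 <= c k s.
  by move=> st; apply: cost_shift_ge0 => // j jk; exact: (hlam jk).1.
have mD : measurable (`[t, T]%classic : set R) by exact: measurable_itv.
have muD : (mu `[t, T] = (T - t)%:E)%E.
  rewrite lebesgue_measure_itv/= lte_fin.
  by move: tT; rewrite le_eqVlt => /predU1P[->|->]//; rewrite ltxx subrr.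
pose Y w := (\int[mu]_(s in `[t, T]) (c (X s w) s)%:E)%E.
have costY w : (\int[mu]_(s in `[t, T]) (cost V r lbar (X s w) (lam s (X s w)))%:E =
    Y w + (- (C * (T - t)))%:E)%E.
  transitivity (\int[mu]_(s in `[t, T]) ((c (X s w) s)%:E + (cst (- C) s)%:E))%E.
    by apply: eq_integral => s _; rewrite -EFinD /c addrK.
  rewrite integralD_ge0l//; first last.
  - by move=> s st; rewrite lee_fin c0.
  - exact: (measurable_running_cost tT mX rcX mc).
  - apply: continuous_compact_integrable; first exact: segment_compact.
    by move=> ?; exact: cvg_cst.
  congr (_ + _)%E; transitivity ((- C)%:E * mu `[t, T])%E.
    exact: (integral_cst mu mD (- C)%:E).
  by rewrite muD -EFinM mulNr.
have tTT : T \in `[t, T] by rewrite in_itv/= tT lexx.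
have mXT k : measurable (X T @^-1` [set k]) by apply: mX; rewrite tT lexx.
have [ih hE] := expectation_finite_range (fun k => C * (T - t) + g k) mXT
  (fun k => pE T k tTT).
have -> : criterion P V r g lbar T t lam X =
    (\int[P]_w ((C * (T - t) + g (X T w))%:E - Y w))%E.
  apply: eq_integral => w _; rewrite costY.
  have : (0 <= Y w)%E by apply: integral_ge0 => s st; rewrite lee_fin c0.
  by case: (Y w) => [y| |]//= _; congr EFin; ring.
rewrite (integralB_ge0r measurableT ih); first last.
- by move=> w _; apply: integral_ge0 => s st; rewrite lee_fin c0.
- exact: (measurable_running_integral tT mX rcX mc c0).
rewrite hE (expectation_running_integral tT mX rcX mc c0 (fun k s st => pE s k st)).
rewrite (integral_expected_cost hV r g hlbar tT i hlam hp).
set G := (\int[mu]_(s in _) _)%E; set a := \sum_k _.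
have : (0 <= G)%E.
  apply: integral_ge0 => s st; rewrite lee_fin sumr_ge0// => k _.
  by rewrite mulr_ge0 ?(marginal_ge0 i hp) ?(hjb_gap_ge0 r g hlbar hlam).
by case: G => [y| |]//= _; congr EFin; ring.
Qed.

Lemma criterion_le :
  (criterion P V r g lbar T t lam X <= (ln (wvec V r g lbar T t i 0))%:E)%E.
Proof.
have /andP[_ tT] := ht.
have [m m0 ->] := criterion_gap; rewrite -[leRHS]sube0 leeB//.
apply: integral_ge0 => s st; rewrite lee_fin sumr_ge0// => k _.
by rewrite mulr_ge0 ?m0 ?(hjb_gap_ge0 r g hlbar hlam).
Qed.

Lemma criterion_eq : lam = opt_control V r g lbar T ->
  criterion P V r g lbar T t lam X = (ln (wvec V r g lbar T t i 0))%:E.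
Proof.
move=> lamE; have [m _ ->] := criterion_gap.
rewrite integral0_eq ?sube0// => s /=; rewrite in_itv/= => /andP[_ sT].
rewrite big1// => k _; rewrite /hjb_gap lamE hjb_eq// subrr mulr0//.
Qed.

End Criterion.

Theorem theorem2 (R : realType) (N : nat) (hN : (2 <= N)%N)
  (V : 'I_N -> {set 'I_N}) (hV : forall i, i \notin V i)
  (r g : 'I_N -> R) (lbar : 'I_N -> 'I_N -> R)
  (hlbar : forall i j, j \in V i -> 0 < lbar i j)
  (T : R) (hT : 0 < T)
  (d : measure_display) (Omega : measurableType d) (P : probability Omega R)
  (F : R -> set (set Omega)) (hF : usual_filtration P T F)
  (X : R -> 'I_N -> (R -> 'I_N -> 'I_N -> R) -> R -> Omega -> 'I_N)
  (hX : forall (t : R) (i : 'I_N) (lam : R -> 'I_N -> 'I_N -> R),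
      0 <= t <= T -> admissible V T t lam ->
      markov_chain P V F T t i lam (X t i lam)) :
  [/\ forall (t : R) (i : 'I_N), 0 <= t <= T -> 0 < wvec V r g lbar T t i 0,
      forall (i : 'I_N) (t : R), 0 <= t <= T ->
        value P V r g lbar T X i t = (ln (wvec V r g lbar T t i 0))%:E,
      admissible V T 0 (opt_control V r g lbar T) &
      forall i : 'I_N,
        ereal_sup [set criterion P V r g lbar T 0 lam (X 0 i lam) |
                   lam in admissible V T 0] =
        criterion P V r g lbar T 0 (opt_control V r g lbar T)
          (X 0 i (opt_control V r g lbar T))].
Proof.
have adm t : 0 <= t <= T -> admissible V T t (opt_control V r g lbar T).
  by move=> /andP[_ tT]; exact: admissible_opt_control.
have attained t i : 0 <= t <= T ->
    criterion P V r g lbar T t (opt_control V r g lbar T)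
      (X t i (opt_control V r g lbar T)) = (ln (wvec V r g lbar T t i 0))%:E.
  move=> ht; have hopt := adm t ht.
  exact: (criterion_eq hV hlbar hF ht hopt (hX t i _ ht hopt)).
have supE t i : 0 <= t <= T -> value P V r g lbar T X i t =
    (ln (wvec V r g lbar T t i 0))%:E.
  move=> ht; apply/eqP; rewrite eq_le; apply/andP; split.
    apply: ge_ereal_sup => _ [lam hlam <-].
    exact: (criterion_le hV r g hlbar hF ht hlam (hX t i lam ht hlam)).
  rewrite -(attained t i ht); apply: ereal_sup_ubound.
  by exists (opt_control V r g lbar T) => //; exact: adm.
have h0 : 0 <= (0 : R) <= T by rewrite lexx ltW.
split.
- by move=> t i /andP[_ tT]; exact: wvec_gt0.
- by move=> i t; exact: supE.
- exact: adm.
- by move=> i; rewrite attained//; exact: supE.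
Qed.
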